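(* Let $n\ge 3$ and let $M^n$ be an $n$-dimensional complete, connected, smooth Riemannian manifold without boundary, with metric $\langle\,,\rangle$, and suppose $M^n$ is isometric to a Riemannian product $N\times\mathbb{R}$ for some Riemannian manifold $N$. Let $f:M^n\to\mathbb{R}$ be a non-trivial affine function, and let $\alpha:I\subset\mathbb{R}\to M^n$ be a Frenet curve of proper $n$ with Frenet frame $\{V_1,\dots,V_n\}$ and harmonic curvatures $\{H_1,\dots,H_{n-2}\}$. If $\alpha$ is an $f$-eikonal helix curve with axis $\nabla f$, then along $\alpha$ the axis is given by $$\nabla f=\|\nabla f\|\cos(\theta)\,\bigl(V_1+H_1V_3+\dots+H_{n-2}V_n\bigr),$$ where $\theta$ is the (constant) angle between $\nabla f$ and $V_1$ along $\alpha$, i.e. $\langle\nabla f,V_1\rangle=\|\nabla f\|\cos(\theta)$.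
   Context: A smooth curve $\alpha=\alpha(s):I\to M^n$ ($I\subset\mathbb{R}$ an interval), parametrized by arc length, is a Frenet curve of proper $n$ if there are orthonormal frame fields $\{V_1=\alpha',V_2,\dots,V_n\}$ along $\alpha$ (the Frenet frame) and positive functions $k_1(s),\dots,k_{n-1}(s)$ (the curvatures) with $$\nabla_{\alpha'}V_i=-k_{i-1}V_{i-1}+k_iV_{i+1},\qquad i=1,\dots,n,$$ where $V_0=V_{n+1}=0$ and $\nabla_{\alpha'}$ is the Riemannian (Levi-Civita) connection along $\alpha$. Harmonic curvatures $H_i:I\to\mathbb{R}$ of $\alpha$, $i=1,\dots,n-2$: with the convention $H_0=0$, $$H_1=\frac{k_1}{k_2},\qquad H_i=\frac{1}{k_{i+1}}\left\{V_1[H_{i-1}]+k_iH_{i-2}\right\}\quad(2\le i\le n-2),$$ where $V_1[H]=H'=dH/ds$. $\nabla f$ is the gradient of the (differentiable) function $f$: $df(X)=\langle\nabla f,X\rangle$. A Frenet curve $\alpha$ is an $f$-eikonal helix curve, with axis $\nabla f$, if $\|\nabla f\|$ is constant along $\alpha$ and the function $\langle\nabla f,V_1\rangle$ is a non-zero constant along $\alpha$. A function $f:M^n\to\mathbb{R}$ is affine if for every geodesic $\gamma$ of $M^n$ (with affine parameter $t$) the function $t\mapsto f(\gamma(t))$ is of the form $at+b$ with $a,b$ real constants; it is non-trivial if it is not constant. *)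

(* Defs.v *)
From HB Require Import structures.
From mathcomp Require Import all_boot all_order all_algebra.
From mathcomp Require Import all_classical all_reals all_analysis.

Set Implicit Arguments.
Unset Strict Implicit.
Unset Printing Implicit Defensive.

Import Order.TTheory GRing.Theory Num.Theory.
Import numFieldNormedType.Exports.

Local Open Scope classical_set_scope.
Local Open Scope ring_scope.

(** [U] is meant to be open: continuity and differentiability at the points of
    [U] are taken in the ambient space. *)
Fixpoint Ck (R : realType) (m : nat) (W : normedModType R) (k : nat)
    (U : set 'rV[R]_m) (f : 'rV[R]_m -> W) : Prop :=
  match k with
  | 0 => forall x, U x -> {for x, continuous f}
  | k'.+1 => (forall x, U x -> differentiable f x) /\
             (forall i : 'I_m, Ck k' U (fun x => 'D_(delta_mx 0 i) f x))
  end.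

Definition smooth_on (R : realType) (m : nat) (W : normedModType R)
    (U : set 'rV[R]_m) (f : 'rV[R]_m -> W) : Prop :=
  forall k, Ck k U f.

(** Derivatives of functions of one variable are taken relative to a set J
    (in practice an interval, or a relatively open subset of one); at an
    endpoint that belongs to J they are one-sided. *)
Definition slope (R : realType) (W : normedModType R) (f : R -> W) (s t : R)
    : W := (t - s)^-1 *: (f t - f s).

Definition derivable_in (R : realType) (W : normedModType R) (J : set R)
    (f : R -> W) (s : R) : Prop :=
  cvg (slope f s @ within J s^').

Definition deriv_in (R : realType) (W : normedModType R) (J : set R)
    (f : R -> W) (s : R) : W :=
  lim (slope f s @ within J s^').

Definition smooth_in (R : realType) (W : normedModType R) (J : set R)
    (f : R -> W) : Prop :=
  forall (k : nat) (s : R), J s -> derivable_in J (iter k (deriv_in J) f) s.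

Definition nondegenerate_interval (R : realType) (I : set R) : Prop :=
  is_interval I /\ exists a b, [/\ I a, I b & a < b].

Record chart (R : realType) (n : nat) (M : topologicalType) := Chart {
  cdom : set M;
  ccod : set 'rV[R]_n;
  crd : M -> 'rV[R]_n;
  prm : 'rV[R]_n -> M;
  cdom_open : open cdom;
  ccod_open : open ccod;
  crd_cod : forall p, cdom p -> ccod (crd p);
  prm_dom : forall x, ccod x -> cdom (prm x);
  crdK : forall p, cdom p -> prm (crd p) = p;
  prmK : forall x, ccod x -> crd (prm x) = x;
  crd_continuous : forall p, cdom p -> {for p, continuous crd};
  prm_continuous : forall x, ccod x -> {for x, continuous prm}
}.

Record manifold (R : realType) (n : nat) := Manifold {
  carrier :> topologicalType;
  carrier_hausdorff : hausdorff_space carrier;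
  carrier_second_countable : @second_countable carrier;
  atlas : set (chart R n carrier);
  transition_smooth : forall c d, atlas c -> atlas d ->
    smooth_on (ccod c `&` prm c @^-1` cdom d) (crd d \o prm c);
  chart_at : carrier -> chart R n carrier;
  chart_at_atlas : forall p, atlas (chart_at p);
  chart_at_dom : forall p, cdom (chart_at p) p
}.

(** The tangent space T_pM is ['rV[R]_n]: a tangent vector at p is given by its
    components in the distinguished chart [chart_at p].  [tcoord c p u] are the
    components of [u] in another chart [c] around p, and [tbasis c p i] is the
    i-th coordinate vector field of [c] at p. *)
Definition tcoord (R : realType) (n : nat) (M : manifold R n)
    (c : chart R n M) (p : M) (u : 'rV[R]_n) : 'rV[R]_n :=
  'd (crd c \o prm (chart_at p)) (crd (chart_at p) p) u.

Definition tbasis (R : realType) (n : nat) (M : manifold R n)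
    (c : chart R n M) (p : M) (i : 'I_n) : 'rV[R]_n :=
  'd (crd (chart_at p) \o prm c) (crd c p) (delta_mx 0 i).

Definition smooth_fun (R : realType) (n : nat) (M : manifold R n)
    (f : M -> R) : Prop :=
  forall c, atlas c -> smooth_on (ccod c) (f \o prm c).

Definition dfun (R : realType) (n : nat) (M : manifold R n) (f : M -> R)
    (p : M) (u : 'rV[R]_n) : R :=
  'd (f \o prm (chart_at p)) (crd (chart_at p) p) u.

Definition smooth_map (R : realType) (m n : nat) (M : manifold R m)
    (N : manifold R n) (F : M -> N) : Prop :=
  continuous F /\
  forall (c : chart R m M) (d : chart R n N), atlas c -> atlas d ->
    smooth_on (ccod c `&` (F \o prm c) @^-1` cdom d) (crd d \o F \o prm c).

Definition dmap (R : realType) (m n : nat) (M : manifold R m)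
    (N : manifold R n) (F : M -> N) (p : M) (u : 'rV[R]_m) : 'rV[R]_n :=
  'd (crd (chart_at (F p)) \o F \o prm (chart_at p)) (crd (chart_at p) p) u.

(** A field [g] of bilinear forms is given by its matrices in the distinguished
    charts; [gram g c x] is its matrix in an arbitrary chart [c] at the point
    with coordinates [x]. *)
Definition form (R : realType) (n : nat) (g : 'M[R]_n) (u v : 'rV[R]_n) : R :=
  (u *m g *m v^T) 0 0.

Definition gram (R : realType) (n : nat) (M : manifold R n)
    (g : M -> 'M[R]_n) (c : chart R n M) (x : 'rV[R]_n) : 'M[R]_n :=
  \matrix_(i, j) form (g (prm c x)) (tbasis c (prm c x) i)
                                    (tbasis c (prm c x) j).

Record riemannian (R : realType) (n : nat) := Riemannian {
  rman :> manifold R n;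
  metric : rman -> 'M[R]_n;
  metric_sym : forall p, (metric p)^T = metric p;
  metric_pos : forall p (u : 'rV[R]_n), u != 0 -> 0 < form (metric p) u u;
  metric_smooth : forall c, atlas c -> forall i j : 'I_n,
    smooth_on (ccod c) (fun x => gram metric c x i j : R)
}.

Definition inner (R : realType) (n : nat) (M : riemannian R n) (p : M)
    (u v : 'rV[R]_n) : R := form (metric p) u v.

Definition tnorm (R : realType) (n : nat) (M : riemannian R n) (p : M)
    (u : 'rV[R]_n) : R := Num.sqrt (inner p u u).

Definition angle (R : realType) (n : nat) (M : riemannian R n) (p : M)
    (u v : 'rV[R]_n) : R := acos (inner p u v / (tnorm p u * tnorm p v)).

Definition grad (R : realType) (n : nat) (M : riemannian R n) (f : M -> R)
    (p : M) : 'rV[R]_n :=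
  (\row_i dfun f p (delta_mx 0 i)) *m invmx (metric p).

Lemma metric_unit (R : realType) (n : nat) (M : riemannian R n) (p : M) :
  metric p \in unitmx.
Proof.
rewrite -row_free_unit -kermx_eq0; apply/negPn/negP => /rowV0Pn[u].
move=> /sub_kermxP ug u0; have := metric_pos p u0.
by rewrite /form ug mul0mx mxE ltxx.
Qed.

Lemma gradP (R : realType) (n : nat) (M : riemannian R n) (f : M -> R) (p : M)
    (u : 'rV[R]_n) : inner p (grad f p) u = dfun f p u.
Proof.
rewrite /inner /form /grad mulmxKV ?metric_unit// mxE.
rewrite [u in RHS]row_sum_delta /dfun linear_sum; apply: eq_bigr => i _.
by rewrite linearZ /= !mxE mulrC.
Qed.

(** Gamma^k_ij in the chart [c], at the point with coordinates [x]. *)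
Definition christoffel (R : realType) (n : nat) (M : riemannian R n)
    (c : chart R n M) (x : 'rV[R]_n) (k i j : 'I_n) : R :=
  let dG (a i j : 'I_n) : R :=
    'D_(delta_mx 0 a) (fun y => gram (@metric R n M) c y i j : R) x in
  2^-1 * \sum_(l < n) invmx (gram (@metric R n M) c x) k l *
    (dG i j l + dG j i l - dG l i j).

Definition christoffel_term (R : realType) (n : nat) (M : riemannian R n)
    (c : chart R n M) (x u v : 'rV[R]_n) : 'rV[R]_n :=
  \row_k \sum_(i < n) \sum_(j < n) christoffel c x k i j * u 0 i * v 0 j.

(** Curves and fields along them are total functions of the parameter, of
    which only the restriction to the parameter interval is relevant. *)

Definition smooth_curve (R : realType) (n : nat) (M : manifold R n)
    (I : set R) (a : R -> M) : Prop :=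
  {within I, continuous a} /\
  forall c : chart R n M, atlas c ->
    smooth_in (I `&` a @^-1` cdom c) (crd c \o a).

Definition smooth_along (R : realType) (n : nat) (M : manifold R n)
    (I : set R) (a : R -> M) (V : R -> 'rV[R]_n) : Prop :=
  forall c : chart R n M, atlas c ->
    smooth_in (I `&` a @^-1` cdom c) (fun s => tcoord c (a s) (V s)).

Definition velocity (R : realType) (n : nat) (M : manifold R n)
    (I : set R) (a : R -> M) (s : R) : 'rV[R]_n :=
  deriv_in I (crd (chart_at (a s)) \o a) s.

(** The covariant derivative along [a] of the field [V], at parameter [s],
    computed in the distinguished chart at [a s]. *)
Definition covderiv (R : realType) (n : nat) (M : riemannian R n)
    (I : set R) (a : R -> M) (V : R -> 'rV[R]_n) (s : R) : 'rV[R]_n :=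
  let c := chart_at (a s) in
  deriv_in I (fun t => tcoord c (a t) (V t)) s +
  christoffel_term c (crd c (a s)) (velocity I a s) (V s).

Definition geodesic (R : realType) (n : nat) (M : riemannian R n)
    (I : set R) (a : R -> M) : Prop :=
  [/\ nondegenerate_interval I, smooth_curve I a &
      forall s, I s -> covderiv I a (velocity I a) s = 0].

Definition complete_riemannian (R : realType) (n : nat) (M : riemannian R n)
    : Prop :=
  forall (p : M) (u : 'rV[R]_n), exists a : R -> M,
    [/\ geodesic [set: R] a, a 0 = p &
        velocity [set: R] a 0 = u :> 'rV[R]_n].

(** [M] is isometric to the Riemannian product N x R: there is a diffeomorphism
    [p |-> (F p, h p)] of M onto N x R, with inverse [E], such that the metric
    of [M] is the pull-back of the product metric.  Smoothness of [E] is
    expressed in the product charts of N x R, whose coordinates are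
    (coordinates in N, real coordinate) : 'rV_(m + 1). *)
Definition isometric_to_line_product (R : realType) (n m : nat)
    (M : riemannian R n) (N : riemannian R m) : Prop :=
  exists (F : M -> N) (h : M -> R) (E : N * R -> M),
    [/\ cancel (fun p => (F p, h p)) E, cancel E (fun p => (F p, h p)),
        smooth_map F /\ smooth_fun h,
        continuous E /\
        (forall (c : chart R m N) (d : chart R n M), atlas c -> atlas d ->
           let Ec (z : 'rV[R]_(m + 1)) :=
             E (prm c (lsubmx z), rsubmx z 0 0) in
           smooth_on [set z : 'rV[R]_(m + 1) | ccod c (lsubmx z) /\
                                               cdom d (Ec z)]
                     (crd d \o Ec)) &
        forall (p : M) (u v : 'rV[R]_n),
          inner p u v = inner (F p) (dmap F p u) (dmap F p v) +
                        dfun h p u * dfun h p v].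

Definition affine_function (R : realType) (n : nat) (M : riemannian R n)
    (f : M -> R) : Prop :=
  forall (I : set R) (c : R -> M), geodesic I c ->
    exists a b : R, forall t, I t -> f (c t) = a * t + b.

Definition nonconstant (T : Type) (R : realType) (f : T -> R) : Prop :=
  exists p q, f p <> f q.

(** Indices start at 1: the frame is V_1, ..., V_n, the curvatures
    are k_1, ..., k_(n-1); V_0 = V_(n+1) = 0, so that the values of k_0 and
    k_n are immaterial. *)
Definition frenet_curve (R : realType) (n : nat) (M : riemannian R n)
    (I : set R) (a : R -> M) (V : nat -> R -> 'rV[R]_n) (k : nat -> R -> R)
    : Prop :=
  [/\ nondegenerate_interval I /\ smooth_curve I a,
      (forall s, I s -> V 1%N s = velocity I a s) /\
      (forall s, I s -> V 0%N s = 0 /\ V n.+1 s = 0),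
      (forall i, (1 <= i <= n)%N -> smooth_along I a (V i)) /\
      (forall i j s, (1 <= i <= n)%N -> (1 <= j <= n)%N -> I s ->
         inner (a s) (V i s) (V j s) = (i == j)%:R),
      (forall i s, (1 <= i < n)%N -> I s -> 0 < k i s) &
      (forall i s, (1 <= i <= n)%N -> I s ->
         covderiv I a (V i) s =
           - k i.-1 s *: V i.-1 s + k i s *: V i.+1 s)].

(** The harmonic curvatures H_1, ..., H_(n-2), with H_0 = 0. *)
Fixpoint harmonic_curvature (R : realType) (I : set R) (k : nat -> R -> R)
    (i : nat) : R -> R :=
  match i with
  | 0 => fun=> 0
  | i'.+1 =>
    match i' with
    | 0 => fun s => k 1%N s / k 2%N s
    | j.+1 => fun s =>
        (k i.+1 s)^-1 *
        (deriv_in I (harmonic_curvature I k i') s +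
         k i s * harmonic_curvature I k j s)
    end
  end.

Definition eikonal_helix (R : realType) (n : nat) (M : riemannian R n)
    (f : M -> R) (I : set R) (a : R -> M) (V : nat -> R -> 'rV[R]_n) : Prop :=
  (exists c : R, forall s, I s -> tnorm (a s) (grad f (a s)) = c) /\
  (exists c : R, c != 0 /\
     forall s, I s -> inner (a s) (grad f (a s)) (V 1%N s) = c).

(* Main.v *)
Require Import Defs.
From mathcomp Require Import all_boot all_order all_algebra.
From mathcomp Require Import all_classical all_reals all_analysis.
From mathcomp Require Import lra ring.
Import Order.TTheory GRing.Theory Num.Theory.
Import numFieldNormedType.Exports.
Local Open Scope classical_set_scope.
Local Open Scope ring_scope.

(** An affine function [f] on a complete manifold has a parallel gradient.  Along
    the geodesic with initial velocity [u] the function is affine in the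
    parameter, so its second derivative, which is Hess f(u, u), vanishes
    ([hessian_diag0]); Hess f is bilinear and symmetric, by Schwarz's theorem
    ([derive_deriveC]) and the symmetry of the Christoffel symbols, hence it
    vanishes identically ([hessian0]).

    Now let l_i = <grad f, V_i> = df(V_i) be the components of the gradient in
    the Frenet frame.  The product rule along a curve ([dfun_slope]) has no
    Hessian term left, and the Frenet equations give
    l_i' = - k_(i-1) l_(i-1) + k_i l_(i+1) ([frame_component_slope]).  The helix
    condition says that l_1 is a nonzero constant c.  Solving the equations one
    after the other gives l_2 = 0, l_3 = c k_1 / k_2 and then
    l_(i+2) = (l_(i+1)' + k_i l_i) / k_(i+1), which is c times the recursion for
    the harmonic curvatures: l_(i+2) = c H_i ([frame_component_helix]).  The
    frame is orthonormal and has n members, so grad f is the sum of the l_i V_i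
    ([orthonormal_expansion]), and c is the product of its norm with cos theta. *)

Set Implicit Arguments.
Unset Strict Implicit.
Unset Printing Implicit Defensive.

(** * Derivatives relative to an interval *)

Lemma diff_expansion (R : realType) (V W : normedModType R) (F : V -> W) x :
  differentiable F x ->
  exists2 e : V -> W,
    (forall h, F (x + h) = F x + 'd F x h + e h) &
    forall eps : R, 0 < eps -> \forall h \near 0, `|e h| <= eps * `|h|.
Proof.
move=> dF; have H := diff_locallyxC dF.
eexists; first by move=> h; rewrite {1}H; reflexivity.
by move=> eps eps0; apply: (littleoP [littleo of _]).
Qed.

Section DerivIn.
Context {R : realType}.
Implicit Types (I : set R) (s : R).

(** An interval with two points accumulates at each of its points, endpoints
    included; hence one-sided limits of slopes are unique there. *)
Lemma within_dnbhs_proper I s : nondegenerate_interval I -> I s ->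
  ProperFilter (within I s^').
Proof.
move=> [Iitv [a [b [Ia Ib ab]]]] Is.
apply: Build_ProperFilter_ex => A; rewrite /within /= => /nbhs_ballP[e /= e0 eA].
have [sb|bs] := ltP s b.
  pose t := Num.min b (s + e / 2).
  have st : s < t by rewrite lt_min sb /=; lra.
  have te : t <= s + e / 2 by rewrite ge_min lexx orbT.
  exists t; apply: eA.
  - by rewrite /ball /= ltr_distlC; apply/andP; split; lra.
  - by rewrite gt_eqF.
  - by apply: (Iitv s b) => //; rewrite (ltW st) ge_min lexx.
have sa : a < s by lra.
pose t := Num.max a (s - e / 2).
have st : t < s by rewrite gt_max sa /=; lra.
have te : s - e / 2 <= t by rewrite le_max lexx orbT.
exists t; apply: eA.
- by rewrite /ball /= ltr_distlC; apply/andP; split; lra.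
- by rewrite lt_eqF.
- by apply: (Iitv a s) => //; rewrite (ltW st) le_max lexx.
Qed.

Section Calculus.
Context {W : normedModType R}.
Implicit Types (f g : R -> W).

(** Taken at [t = s] too, where both sides are [f s] although the slope is a
    division by zero. *)
Lemma slopeK f s t : f t = (t - s) *: slope f s t + f s.
Proof.
rewrite /slope; have [->|ts] := eqVneq t s.
  by rewrite subrr scale0r add0r.
by rewrite scalerA divff ?scale1r ?subrK // subr_eq0.
Qed.

Lemma slope_cvg_continuous I f s (l : W) :
  slope f s @ within I s^' --> l -> f @ within I s^' --> f s.
Proof.
move=> fl; have fE : (fun t => (t - s) *: slope f s t + f s) = f.
  by apply/funext => t; rewrite -slopeK.
suff : (fun t => (t - s) *: slope f s t + f s) @ within I s^' --> 0 *: l + f s.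
  by rewrite fE scale0r add0r.
apply: cvgD; last exact: cvg_cst.
apply: cvgZ => //; rewrite -[X in _ --> X](subrr s); apply: cvgB; last exact: cvg_cst.
by apply: cvg_trans; [exact: cvg_within|exact: cvg_within].
Qed.

(** The hypothesis at the point [s] itself is separate because the punctured
    filter does not see it, while every slope does. *)
Lemma near_eq_slope I f g s : (\forall t \near within I s^', f t = g t) ->
  f s = g s -> forall l : W, slope f s @ within I s^' --> l ->
  slope g s @ within I s^' --> l.
Proof.
move=> fg fgs l; apply: cvg_trans; apply: near_eq_cvg.
by apply: filterS fg => t ft; rewrite /slope ft fgs.
Qed.

Lemma deriv_in_eq I f s (l : W) : nondegenerate_interval I -> I s ->
  slope f s @ within I s^' --> l -> deriv_in I f s = l.
Proof.
move=> Ii Is fl; have PF := within_dnbhs_proper Ii Is.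
exact: (cvg_lim _ fl).
Qed.

Lemma slope_cvg_unique I f s (l l' : W) : nondegenerate_interval I -> I s ->
  slope f s @ within I s^' --> l -> slope f s @ within I s^' --> l' -> l = l'.
Proof. by move=> Ii Is /(deriv_in_eq Ii Is) <- /(deriv_in_eq Ii Is). Qed.

Lemma slope_cvg_const I f s (a : W) : (forall t, I t -> f t = a) -> I s ->
  slope f s @ within I s^' --> 0.
Proof.
move=> fa Is; have s0 : slope (cst a) s = cst 0.
  by apply/funext => t; rewrite /slope subrr scaler0.
apply: (@near_eq_slope _ (cst a)); last by rewrite s0; exact: cvg_cst.
  by apply: filterS (near_withinT I _) => t It; rewrite fa.
by rewrite fa.
Qed.

End Calculus.

(** The remainder of [F] at [f s] is o(f t - f s); divided by t - s it is
    o(slope), and slopes are bounded near [s] because they converge. *)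
Lemma slope_comp_diff (V W : normedModType R) I (f : R -> V) (F : V -> W) s (l : V) :
  differentiable F (f s) -> slope f s @ within I s^' --> l ->
  slope (F \o f) s @ within I s^' --> 'd F (f s) l.
Proof.
move=> dF fl.
have [e Fe eo] := diff_expansion dF.
have -> : slope (F \o f) s = (fun t => 'd F (f s) (slope f s t) +
    (t - s)^-1 *: e (f t - f s)).
  apply/funext => t; rewrite /slope /= -{1}(subrK (f s) (f t)) [_ - _ + _]addrC Fe.
  rewrite linearZ /= -scalerDr; congr (_ *: _).
  by rewrite -(addrA (F (f s))) [F (f s) + _]addrC addrK.
rewrite -[X in _ --> X]addr0; apply: cvgD.
  by apply: continuous_cvg => //; apply: diff_continuous.
apply/cvgr0Pnorm_le => /= eps eps0.
have dl : \forall t \near within I s^', `|slope f s t| < `|l| + 1.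
  have nl : (fun t => `|slope f s t|) @ within I s^' --> `|l| by exact: cvg_norm.
  move/cvgrPdist_lt : nl => /(_ _ ltr01).
  by apply: filterS => t; rewrite /= ltr_distlC => /andP[].
have l0 : 0 < `|l| + 1 by rewrite ltr_wpDl.
have e0 : 0 < eps / (`|l| + 1) by rewrite divr_gt0.
have f0 : (fun t => f t - f s) @ within I s^' --> (0 : V).
  rewrite -(subrr (f s)); apply: cvgB; last exact: cvg_cst.
  exact: slope_cvg_continuous fl.
have := f0 _ (eo _ e0); rewrite /= near_simpl => {}eo.
near=> t.
have ht : `|e (f t - f s)| <= eps / (`|l| + 1) * `|f t - f s| by near: t.
rewrite normrZ (le_trans (ler_wpM2l _ ht))// mulrCA -normrZ.
rewrite -[leRHS](divfK (lt0r_neq0 l0)) ler_wpM2l ?(ltW e0) //.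
by apply: ltW; near: t.
Unshelve. all: by end_near. Qed.

Lemma slope_sum (W : normedModType R) I m (f : 'I_m -> R -> W) s (l : 'I_m -> W) :
  (forall i, slope (f i) s @ within I s^' --> l i) ->
  slope (fun t => \sum_i f i t) s @ within I s^' --> \sum_i l i.
Proof.
move=> fl; rewrite (_ : slope _ _ = (fun t => \sum_i slope (f i) s t)).
  by apply: cvg_big => [|i _]; [exact: add_continuous|exact: fl].
by apply/funext => t; rewrite /slope -scaler_sumr sumrB.
Qed.

Lemma slopeM I (f g : R -> R) s (l m : R) :
  slope f s @ within I s^' --> l -> slope g s @ within I s^' --> m ->
  slope (fun t => f t * g t) s @ within I s^' --> l * g s + f s * m.
Proof.
move=> fl gm.
rewrite (_ : slope _ _ = (fun t => slope f s t * g t + f s * slope g s t)).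
  apply: cvgD; first by apply: cvgM => //; exact: slope_cvg_continuous gm.
  by apply: cvgM => //; exact: cvg_cst.
apply/funext => t; rewrite /slope /GRing.scale /=; ring.
Qed.

End DerivIn.

(** * Symmetry of second derivatives *)

Section Schwarz.
Context {R : realType} {V : normedModType R}.
Implicit Types (F : V -> R) (x u v : V).

(** The signed sum of [F] over the corners of a parallelogram at [x], whose
    quotient by [h ^+ 2] approximates the mixed second derivative. *)
Definition second_difference F x u v (h : R) : R :=
  F (x + h *: u + h *: v) - F (x + h *: u) - F (x + h *: v) + F x.

Lemma second_differenceC F x u v h :
  second_difference F x u v h = second_difference F x v u h.
Proof. by rewrite /second_difference (addrAC x); ring. Qed.

Lemma derive_line F x u (t : R) : differentiable F (x + t *: u) ->
  is_derive t (1 : R) (fun t : R => F (x + t *: u)) ('D_u F (x + t *: u)).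
Proof.
move=> dF; have dD : derivable F (x + t *: u) u by exact: diff_derivable.
have E : (fun h : R => h^-1 *: (((fun t : R => F (x + t *: u)) \o shift t) (h *: 1) -
    F (x + t *: u))) =
    (fun h : R => h^-1 *: ((F \o shift (x + t *: u)) (h *: u) - F (x + t *: u))).
  apply/funext => h /=; congr (_ *: (F _ - _)).
  by rewrite scalerDl addrCA [h *: 1]mulr1.
by apply: DeriveDef; [rewrite /derivable E|rewrite /derive E].
Qed.

(** The second difference is the increment, over a side parallel to [u], of the
    difference of [F] between two such sides.  The mean value theorem turns it
    into [h] times a difference of values of ['D_u F] at two points that are
    [h *: v] apart, which the differentiability of ['D_u F] at [x] evaluates. *)
Lemma second_difference_cvg F x u v :
  (\forall y \near x, differentiable F y) -> differentiable ('D_u F) x ->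
  (fun h => h ^- 2 * second_difference F x u v h) @ 0^'+ --> 'D_v ('D_u F) x.
Proof.
move=> dF; set G := 'D_u F => dG.
have [e Ge eo] := diff_expansion dG.
apply/cvgrPdist_le => eps eps0.
(* every point of the parallelogram of side h is within h * K of x; the summand
   1 keeps K positive when u and v vanish *)
pose K := `|u| + `|v| + 1.
have K0 : 0 < K by rewrite ltr_wpDl // addr_ge0.
(* two remainders, each at most d * (h * K), must add up to h * eps *)
pose d := eps / (2 * K).
have d0 : 0 < d by rewrite divr_gt0 // mulr_gt0.
have /nbhs_normP[r1 /= r10 Hr1] := dF.
have /nbhs_normP[r2 /= r20 Hr2] := eo _ d0.
have small (a b h : R) : 0 < h -> 0 <= a <= h -> 0 <= b <= h ->
    `|a *: u + b *: v| <= h * K.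
  move=> h0 /andP[a0 ah] /andP[b0 bh].
  rewrite (le_trans (ler_normD _ _))// !normrZ !ger0_norm //.
  rewrite /K !mulrDr mulr1 -[leLHS]addr0 lerD // ?(ltW h0)//.
  by rewrite lerD // ler_wpM2r.
near=> h.
have h0 : 0 < h by near: h; exact: nbhs_right_gt.
have hr1 : h * K < r1.
  by rewrite -ltr_pdivlMr //; near: h; apply: nbhs_right_lt; rewrite divr_gt0.
have hr2 : h * K < r2.
  by rewrite -ltr_pdivlMr //; near: h; apply: nbhs_right_lt; rewrite divr_gt0.
have dFin (a b : R) : 0 <= a <= h -> 0 <= b <= h ->
    differentiable F (x + a *: u + b *: v).
  move=> ah bh; apply: Hr1; rewrite /ball_ /= -addrA opprD addNKr normrN.
  exact: le_lt_trans (small _ _ _ h0 ah bh) hr1.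
have ein (a b : R) : 0 <= a <= h -> 0 <= b <= h ->
    `|e (a *: u + b *: v)| <= d * (h * K).
  move=> ah bh; have S := small _ _ _ h0 ah bh.
  apply: le_trans (ler_wpM2l (ltW d0) S); apply: Hr2.
  by rewrite /ball_ /= sub0r normrN; exact: le_lt_trans S hr2.
(* the difference between the two sides parallel to u, as a function of the
   position along them *)
pose phi t := F (x + h *: v + t *: u) - F (x + t *: u).
have hh : 0 <= h <= h by rewrite lexx ltW.
have z0 : 0 <= (0 : R) <= h by rewrite lexx ltW.
have dphi (t : R) : 0 <= t <= h ->
    is_derive t 1 phi (G (x + h *: v + t *: u) - G (x + t *: u)).
  move=> th; apply: is_deriveB; apply: derive_line.
    by rewrite addrAC; exact: dFin.
  by have := dFin _ _ th z0; rewrite scale0r addr0.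
have [c ch E] : exists2 c, c \in `]0, h[%R & phi h - phi 0 =
    (G (x + h *: v + c *: u) - G (x + c *: u)) * (h - 0).
  apply: (@MVT _ phi (fun t => G (x + h *: v + t *: u) - G (x + t *: u))) => //.
    by move=> t; rewrite in_itv /= => /andP[t0 th]; apply: dphi; rewrite !ltW.
  apply: derivable_within_continuous => t; rewrite in_itv /= => th.
  by apply: ex_derive; exact: dphi.
have {}ch : 0 <= c <= h by move: ch; rewrite in_itv /= => /andP[/ltW -> /ltW ->].
have -> : second_difference F x u v h = phi h - phi 0.
  rewrite /second_difference /phi !scale0r !addr0 (addrAC x); ring.
have xhc : x + h *: v + c *: u = x + (c *: u + h *: v).
  by rewrite -addrA [h *: v + _]addrC.
have xc : x + c *: u = x + (c *: u + 0 *: v) by rewrite scale0r addr0.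
rewrite xhc xc in E; rewrite E subr0 !Ge deriveE //.
have L (p q : R) : 'd G x (p *: u + q *: v) = p * 'd G x u + q * 'd G x v.
  by rewrite linearD !linearZ.
rewrite !L; have h00 : h != 0 by rewrite gt_eqF.
set A := 'd G x u; set B := 'd G x v.
set e1 := e _; set e2 := e _.
have -> : B - h ^- 2 * ((G x + (c * A + h * B) + e1 -
    (G x + (c * A + 0 * B) + e2)) * h) = h^-1 * (e2 - e1) by field.
rewrite normrM gtr0_norm ?invr_gt0 // ler_pdivrMl //.
rewrite (le_trans (ler_normB _ _)) // (le_trans (lerD (ein _ _ ch z0) (ein _ _ ch hh))) //.
rewrite /d le_eqVlt; apply/orP; left; apply/eqP; field.
by rewrite gt_eqF.
Unshelve. all: by end_near. Qed.

(** Schwarz's theorem, in the form due to Young: differentiability of the first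
    derivatives at the point suffices.  Both mixed derivatives are limits of the
    same second difference, which is symmetric in the two directions. *)
Lemma derive_deriveC F x u v :
  (\forall y \near x, differentiable F y) ->
  differentiable ('D_u F) x -> differentiable ('D_v F) x ->
  'D_v ('D_u F) x = 'D_u ('D_v F) x.
Proof.
move=> dF du dv; have := @second_difference_cvg F x v u dF dv.
rewrite (_ : (fun h => _) = (fun h => h ^- 2 * second_difference F x u v h)).
  move=> H; have := cvg_unique _ (@second_difference_cvg F x u v dF du) H.
  by apply; exact: norm_hausdorff.
by apply/funext => h; rewrite second_differenceC.
Qed.

End Schwarz.

(** * Independence of charts *)

Section Charts.
Context {R : realType} {n : nat} {M : manifold R n}.
Implicit Types (c d : chart R n M) (p : M) (f : M -> R) (I : set R) (a : R -> M).

(** Coordinate expressions in two charts agree only where both are defined, so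
    derivatives can be compared once this is known to be a neighbourhood. *)
Lemma near_cdom c d p : cdom c p -> cdom d p ->
  \forall y \near crd d p, cdom c (prm d y).
Proof.
move=> cp dp; have cpr := prm_continuous (crd_cod dp).
apply: (cpr (cdom c)); rewrite crdK //.
by apply: open_nbhs_nbhs; split => //; exact: cdom_open.
Qed.

Lemma near_ccod c p : cdom c p -> \forall y \near crd c p, ccod c y.
Proof.
by move=> cp; apply: open_nbhs_nbhs; split; [exact: ccod_open|exact: crd_cod].
Qed.

Lemma differentiable_transition c d p : atlas c -> atlas d ->
  cdom c p -> cdom d p -> differentiable (crd d \o prm c) (crd c p).
Proof.
move=> ca da cp dp; have [H _] := transition_smooth ca da 1%N.
by apply: H; split; [exact: crd_cod|rewrite /= crdK].
Qed.

Lemma smooth_fun_differentiable f c y : smooth_fun f -> atlas c -> ccod c y ->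
  differentiable (f \o prm c) y.
Proof. by move=> fs ca cy; have [H _] := fs _ ca 1%N; exact: H. Qed.

Lemma smooth_fun_differentiable2 f c y (i : 'I_n) : smooth_fun f -> atlas c ->
  ccod c y -> differentiable ('D_(delta_mx 0 i) (f \o prm c)) y.
Proof. by move=> fs ca cy; have [_ /(_ i) [H _]] := fs _ ca 2%N; exact: H. Qed.

Lemma diff_near_eq (V W : normedModType R) (F G : V -> W) x v :
  differentiable F x -> differentiable G x -> (\forall y \near x, F y = G y) ->
  'd F x v = 'd G x v.
Proof. by move=> dF dG FG; rewrite -!deriveE //; exact: near_eq_derive. Qed.

Lemma tcoord_chart_at p v : tcoord (chart_at p) p v = v.
Proof.
have cp := chart_at_dom p; have ca := chart_at_atlas p.
transitivity ('d (@id 'rV[R]_n) (crd (chart_at p) p) v); last by rewrite diff_val.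
apply: diff_near_eq; first exact: differentiable_transition.
  exact: ex_diff.
by apply: filterS (near_ccod cp) => y cy; rewrite /= prmK.
Qed.

(** The differential of a function does not depend on the chart: the chain rule
    for the change of coordinates from the distinguished chart at [p] to [c]. *)
Lemma dfun_chart f c p v : smooth_fun f -> atlas c -> cdom c p ->
  dfun f p v = 'd (f \o prm c) (crd c p) (tcoord c p v).
Proof.
move=> fs ca cp; have dp := chart_at_dom p; have da := chart_at_atlas p.
rewrite /dfun /tcoord; set d := chart_at p in dp da *.
have dT := differentiable_transition da ca dp cp.
have Tp : (crd c \o prm d) (crd d p) = crd c p by rewrite /= crdK.
have dF : differentiable (f \o prm c) ((crd c \o prm d) (crd d p)).
  by rewrite Tp; apply: smooth_fun_differentiable => //; exact: crd_cod.
transitivity ('d ((f \o prm c) \o (crd c \o prm d)) (crd d p) v).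
  apply: diff_near_eq.
  - by apply: smooth_fun_differentiable => //; exact: crd_cod.
  - exact: differentiable_comp.
  - by apply: filterS (near_cdom cp dp) => y cy; rewrite /= crdK.
apply: etrans (congr1 (@^~ v) (diff_comp dT dF)) _.
by rewrite Tp.
Qed.

Lemma near_curve_cdom I a c s : {within I, continuous a} -> I s ->
  cdom c (a s) -> \forall t \near within I (nbhs s), cdom c (a t).
Proof.
move=> /subspace_continuousP ac Is cs.
apply: (ac _ Is (cdom c)); apply: open_nbhs_nbhs; split => //; exact: cdom_open.
Qed.

Lemma near_curve_cdom_punctured I a c s : {within I, continuous a} -> I s ->
  cdom c (a s) -> \forall t \near within I s^', cdom c (a t).
Proof.
move=> ac Is cs; have := near_curve_cdom ac Is cs.
rewrite !near_withinE /=; apply: cvg_within.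
Qed.

(** Smoothness of a curve is assumed relative to the parameters that the curve
    sends into a chart, while velocities are derivatives relative to the whole
    interval; by continuity both refer to the same filter. *)
Lemma within_curve_cdom I a c s : {within I, continuous a} -> I s ->
  cdom c (a s) -> within (I `&` a @^-1` cdom c) s^' = within I s^'.
Proof.
move=> ac Is cs.
have H : \forall t \near s^', I t -> cdom c (a t) := near_curve_cdom_punctured ac Is cs.
rewrite /within; apply/seteqP; split => A /= AI.
  by apply: filterS2 H AI => t ct At It; apply: At; split => //; exact: ct.
by apply: filterS AI => t At [It _]; exact: At.
Qed.

Lemma smooth_curve_slope I a c s : nondegenerate_interval I ->
  smooth_curve I a -> I s -> atlas c -> cdom c (a s) ->
  slope (crd c \o a) s @ within I s^' --> deriv_in I (crd c \o a) s.
Proof.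
move=> Ii [ac asm] Is ca cs; have := asm c ca 0%N s (conj Is cs).
by rewrite /derivable_in /deriv_in (within_curve_cdom ac Is cs).
Qed.

Lemma velocity_slope I a s : nondegenerate_interval I ->
  smooth_curve I a -> I s ->
  slope (crd (chart_at (a s)) \o a) s @ within I s^' --> velocity I a s.
Proof.
move=> Ii sm Is; apply: smooth_curve_slope => //.
  exact: chart_at_atlas.
exact: chart_at_dom.
Qed.

(** The velocity is read in a chart that depends on the parameter; this gives
    its components in one fixed chart, where it can be differentiated again. *)
Lemma tcoord_velocity I a c s : nondegenerate_interval I ->
  smooth_curve I a -> I s -> atlas c -> cdom c (a s) ->
  tcoord c (a s) (velocity I a s) = deriv_in I (crd c \o a) s.
Proof.
move=> Ii sm Is ca cs; have dp := chart_at_dom (a s).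
have da := chart_at_atlas (a s).
have dT := differentiable_transition da ca dp cs.
apply: (slope_cvg_unique Ii Is) (smooth_curve_slope Ii sm Is ca cs).
have := slope_comp_diff dT (velocity_slope Ii sm Is).
apply: near_eq_slope; last by rewrite /= crdK.
have := near_curve_cdom_punctured sm.1 Is dp.
by apply: filterS => t dt; rewrite /= crdK.
Qed.

Lemma dfun_velocity f I a s : smooth_fun f -> nondegenerate_interval I ->
  smooth_curve I a -> I s ->
  slope (f \o a) s @ within I s^' --> dfun f (a s) (velocity I a s).
Proof.
move=> fs Ii sm Is; have dp := chart_at_dom (a s).
have da := chart_at_atlas (a s).
have dF := smooth_fun_differentiable fs da (crd_cod dp).
have := slope_comp_diff dF (velocity_slope Ii sm Is).
apply: near_eq_slope; last by rewrite /= crdK.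
have := near_curve_cdom_punctured sm.1 Is dp.
by apply: filterS => t dt; rewrite /= crdK.
Qed.

End Charts.

(** * The Hessian of an affine function *)

Section Hessian.
Context {R : realType} {n : nat} {M : riemannian R n}.
Implicit Types (c : chart R n M) (p : M) (f : M -> R) (I : set R) (a : R -> M)
  (u v w : 'rV[R]_n).

Definition second_derivative (F : 'rV[R]_n -> R) x u v : R :=
  \sum_j 'd ('D_(delta_mx 0 j) F) x u * v 0 j.

(** The covariant Hessian at [p], in the distinguished chart there: second
    partial derivatives corrected by the Christoffel symbols. *)
Definition hessian f p u v : R :=
  let c := chart_at p in
  second_derivative (f \o prm c) (crd c p) u v -
  dfun f p (christoffel_term c (crd c p) u v).

Lemma diff_coordE (F : 'rV[R]_n -> R) x v : differentiable F x ->
  'd F x v = \sum_i v 0 i * 'D_(delta_mx 0 i) F x.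
Proof.
move=> dF; rewrite [v in LHS]row_sum_delta linear_sum; apply: eq_bigr => i _.
by rewrite linearZ deriveE.
Qed.

Lemma slope_coord I (w : R -> 'rV[R]_n) s (l : 'rV[R]_n) j :
  slope w s @ within I s^' --> l ->
  slope (fun t => w t 0 j) s @ within I s^' --> l 0 j.
Proof.
move=> wl; rewrite (_ : slope _ _ = (fun t => slope w s t 0 j)).
  exact: (@cvg_comp _ _ _ (slope w s) (fun x : 'rV[R]_n => x 0 j) _ _ _ wl (@coord_continuous _ _ _ 0 j l)).
by apply/funext => t; rewrite /slope !mxE.
Qed.

Lemma dfunD f p u v : dfun f p (u + v) = dfun f p u + dfun f p v.
Proof. by rewrite /dfun linearD. Qed.

Lemma dfunZ f p (r : R) u : dfun f p (r *: u) = r * dfun f p u.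
Proof. by rewrite /dfun linearZ. Qed.

Lemma dfun0 f p : dfun f p 0 = 0.
Proof. by rewrite /dfun linear0. Qed.

(** The product rule d/ds (df(W)) = Hess f(a', W) + df(DW/ds).  In the chart at
    [a s] one has df(W) = sum_j d_jF(x(t)) w_j(t); the Christoffel term that the
    covariant derivative adds to w' is the one that the Hessian subtracts. *)
Lemma dfun_slope f I a W s : smooth_fun f -> nondegenerate_interval I ->
  smooth_curve I a -> I s ->
  derivable_in I (fun t => tcoord (chart_at (a s)) (a t) (W t)) s ->
  slope (fun t => dfun f (a t) (W t)) s @ within I s^' -->
    hessian f (a s) (velocity I a s) (W s) + dfun f (a s) (covderiv I a W s).
Proof.
move=> fs Ii sm Is dW; have cs := chart_at_dom (a s).
have ca := chart_at_atlas (a s).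
rewrite /hessian /covderiv; set c := chart_at (a s) in cs ca dW *.
set F := f \o prm c; set x := crd c (a s).
set w := fun t => tcoord c (a t) (W t) in dW *.
have wl : slope w s @ within I s^' --> deriv_in I w s by exact: dW.
have al := velocity_slope Ii sm Is.
have ws : w s = W s by rewrite /w tcoord_chart_at.
have dFx t : cdom c (a t) -> differentiable F (crd c (a t)).
  by move=> ct; apply: smooth_fun_differentiable => //; exact: crd_cod.
rewrite dfunD addrACA [- _ + _]addrC subrr addr0.
have -> : second_derivative F x (velocity I a s) (W s) +
    dfun f (a s) (deriv_in I w s) =
    \sum_j ('d ('D_(delta_mx 0 j) F) x (velocity I a s) * w s 0 j +
            'D_(delta_mx 0 j) F x * deriv_in I w s 0 j).
  rewrite big_split /= ws; congr (_ + _) => //.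
  rewrite /dfun diff_coordE; last exact: dFx.
  by apply: eq_bigr => j _; rewrite mulrC.
have near_c := near_curve_cdom_punctured sm.1 Is cs.
have dfE t : cdom c (a t) ->
    \sum_j 'D_(delta_mx 0 j) F (crd c (a t)) * w t 0 j = dfun f (a t) (W t).
  move=> ct; rewrite (dfun_chart _ fs ca ct) diff_coordE; last exact: dFx.
  by apply: eq_bigr => j _; rewrite mulrC.
apply: (@near_eq_slope _ _ _ (fun t =>
  \sum_j 'D_(delta_mx 0 j) F (crd c (a t)) * w t 0 j)).
- by apply: filterS near_c => t; exact: dfE.
- exact: dfE.
apply: (@slope_sum _ _ I n
  (fun j t => 'D_(delta_mx 0 j) F (crd c (a t)) * w t 0 j) s) => j.
apply: (@slopeM _ I (fun t => 'D_(delta_mx 0 j) F (crd c (a t)))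
  (fun t => w t 0 j)); last exact: slope_coord wl.
have dG : differentiable ('D_(delta_mx 0 j) F) x.
  by apply: smooth_fun_differentiable2 => //; exact: crd_cod.
exact: (slope_comp_diff dG al).
Qed.

(** The expression in coordinates is a double sum of mixed partial derivatives,
    which Schwarz's theorem exchanges. *)
Lemma second_derivative_sym (F : 'rV[R]_n -> R) x u v :
  (\forall y \near x, differentiable F y) ->
  (forall j, differentiable ('D_(delta_mx 0 j) F) x) ->
  second_derivative F x u v = second_derivative F x v u.
Proof.
move=> dF dG.
have E u' v' : second_derivative F x u' v' =
    \sum_j \sum_i u' 0 i * 'D_(delta_mx 0 i) ('D_(delta_mx 0 j) F) x * v' 0 j.
  by apply: eq_bigr => j _; rewrite diff_coordE // mulr_suml.
rewrite !E exchange_big /=; apply: eq_bigr => i _; apply: eq_bigr => j _.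
rewrite (derive_deriveC dF) //; ring.
Qed.

Lemma formC (g : 'M[R]_n) u v : g^T = g -> Defs.form g u v = Defs.form g v u.
Proof.
move=> gs; rewrite /Defs.form -[u *m g *m v^T]trmxK mxE.
by rewrite !trmx_mul trmxK gs mulmxA.
Qed.

Lemma gramC c x i j : gram (@metric R n M) c x i j = gram (@metric R n M) c x j i.
Proof. by rewrite !mxE formC // Defs.metric_sym. Qed.

(** The first two derivatives of the metric are exchanged, and the third one is
    that of a symmetric matrix. *)
Lemma christoffelC c x k i j : christoffel c x k i j = christoffel c x k j i.
Proof.
rewrite /christoffel; congr (_ * _); apply: eq_bigr => l _; congr (_ * _).
have -> : (fun y => gram (@metric R n M) c y i j : R) =
    (fun y => gram (@metric R n M) c y j i) by apply/funext => y; exact: gramC.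
by congr (_ - _); exact: addrC.
Qed.

Lemma christoffel_termC c x u v : christoffel_term c x u v = christoffel_term c x v u.
Proof.
apply/rowP => k; rewrite !mxE exchange_big /=.
apply: eq_bigr => i _; apply: eq_bigr => j _.
by rewrite christoffelC mulrAC.
Qed.

Lemma christoffel_termDl c x u1 u2 v : christoffel_term c x (u1 + u2) v =
  christoffel_term c x u1 v + christoffel_term c x u2 v.
Proof.
apply/rowP => k; rewrite !mxE -big_split; apply: eq_bigr => i _.
by rewrite -big_split; apply: eq_bigr => j _; rewrite /= !mxE mulrDr mulrDl.
Qed.

Lemma hessianC f p u v : smooth_fun f -> hessian f p u v = hessian f p v u.
Proof.
move=> fs; have cp := chart_at_dom p; have ca := chart_at_atlas p.
rewrite /hessian christoffel_termC second_derivative_sym //.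
  by apply: filterS (near_ccod cp) => y cy; exact: smooth_fun_differentiable.
by move=> j; apply: smooth_fun_differentiable2 => //; exact: crd_cod.
Qed.

Lemma hessianDl f p u1 u2 v :
  hessian f p (u1 + u2) v = hessian f p u1 v + hessian f p u2 v.
Proof.
rewrite /hessian christoffel_termDl dfunD opprD addrACA; congr (_ + _).
rewrite /second_derivative -big_split; apply: eq_bigr => j _.
by rewrite linearD mulrDl.
Qed.

(** Completeness provides a geodesic [a] with initial velocity [u].  As [f] is
    affine along it, df(a') is constant; its derivative is Hess f(a', a'), since
    the other term of the product rule contains the acceleration. *)
Lemma hessian_diag0 f p u : complete_riemannian M -> smooth_fun f ->
  affine_function f -> hessian f p u u = 0.
Proof.
move=> Mc fs fa; have [a [ga a0 v0]] := Mc p u.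
have [Ii sm geo] := ga; have [A [B fE]] := fa _ _ ga.
have Is (t : R) : [set: R] t by [].
have dfA t : dfun f (a t) (velocity [set: R] a t) = A.
  have H1 := dfun_velocity fs Ii sm (Is t).
  apply: (slope_cvg_unique Ii (Is t) H1).
  (* the slopes of r |-> A * r + B are all equal to A *)
  apply: cvg_near_cst; rewrite near_withinE near_withinE.
  near=> r => rt _; rewrite /slope /= !fE // opprD addrACA subrr addr0 -mulrBr.
  by rewrite /GRing.scale /= mulrCA mulVf ?subr_eq0 // mulr1.
have cs := chart_at_dom (a 0); have ca := chart_at_atlas (a 0).
have dW : derivable_in [set: R]
    (fun t => tcoord (chart_at (a 0)) (a t) (velocity [set: R] a t)) 0.
  have := sm.2 _ ca 1%N 0 (conj (Is 0) cs).
  rewrite /derivable_in (within_curve_cdom sm.1 (Is 0) cs) => /cvg_ex[l Hl].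
  apply/cvg_ex; exists l; apply: near_eq_slope Hl => /=; last first.
    rewrite tcoord_velocity // /deriv_in.
    by rewrite (within_curve_cdom sm.1 (Is 0) cs).
  apply: filterS (near_curve_cdom_punctured sm.1 (Is 0) cs) => t ct.
  by rewrite tcoord_velocity // /deriv_in (within_curve_cdom sm.1 (Is t) ct).
have H := dfun_slope fs Ii sm (Is 0) dW.
have H0 := slope_cvg_const (fun t _ => dfA t) (Is 0).
have := slope_cvg_unique Ii (Is 0) H H0.
by rewrite geo // dfun0 addr0 v0 a0.
Unshelve. all: by end_near. Qed.

(** Polarization of a symmetric bilinear form that vanishes on the diagonal. *)
Lemma hessian0 f p u v : complete_riemannian M -> smooth_fun f ->
  affine_function f -> hessian f p u v = 0.
Proof.
move=> Mc fs fa; have D w := hessian_diag0 p w Mc fs fa.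
have := D (u + v); rewrite hessianDl ![hessian f p _ (u + v)]hessianC //.
rewrite !hessianDl !D add0r addr0 (hessianC p v u) //.
by move=> /eqP; rewrite -mulr2n mulrn_eq0 /= => /eqP.
Qed.

End Hessian.

(** * Orthonormal frames *)

Section Frame.
Context {R : realType} {n : nat} {M : riemannian R n}.

Lemma innerDl (p : M) (u v w : 'rV[R]_n) :
  inner p (u + v) w = inner p u w + inner p v w.
Proof. by rewrite /inner /Defs.form !mulmxDl mxE. Qed.

Lemma innerZl (p : M) c (u w : 'rV[R]_n) : inner p (c *: u) w = c * inner p u w.
Proof. by rewrite /inner /Defs.form -!scalemxAl mxE. Qed.

Lemma innerC (p : M) (u v : 'rV[R]_n) : inner p u v = inner p v u.
Proof. by rewrite /inner formC // Defs.metric_sym. Qed.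

Lemma inner_ge0 (p : M) (u : 'rV[R]_n) : 0 <= inner p u u.
Proof.
have [->|u0] := eqVneq u 0; last exact/ltW/metric_pos.
by rewrite /inner /Defs.form !mul0mx mxE.
Qed.

(** If the rows of [A] are the [e i] and [g] is the metric, orthonormality reads
    A (g A^T) = 1, so that g A^T is also a left inverse: w = (w g A^T) A, and
    the entries of w g A^T are the inner products of w with the [e i]. *)
Lemma orthonormal_expansion (p : M) (e : 'I_n -> 'rV[R]_n) (w : 'rV[R]_n) :
  (forall i j, inner p (e i) (e j) = (i == j)%:R) ->
  w = \sum_i inner p w (e i) *: e i.
Proof.
move=> eo; pose A : 'M[R]_n := \matrix_i e i.
have entry (v : 'rV[R]_n) i : (v *m metric p *m A^T) 0 i = inner p v (e i).
  rewrite /inner /Defs.form [LHS]mxE [RHS]mxE; apply: eq_bigr => j _.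
  by rewrite !mxE.
have A1 : A *m (metric p *m A^T) = 1%:M.
  apply/matrixP => i j; rewrite mulmxA !mxE -eo -entry mxE.
  apply: eq_bigr => k _; congr (_ * _).
  by rewrite !mxE; apply: eq_bigr => l _; rewrite !mxE.
have {1}-> : w = w *m metric p *m A^T *m A.
  by rewrite -!mulmxA (mulmxA (metric p)) (mulmx1C A1) mulmx1.
rewrite mulmx_sum_row; apply: eq_bigr => i _.
by rewrite entry rowK.
Qed.

(** The Cauchy-Schwarz inequality for a unit vector [v]: the component of [u]
    orthogonal to [v] has nonnegative square norm. *)
Lemma inner_unit_le (p : M) (u v : 'rV[R]_n) : inner p v v = 1 ->
  inner p u v ^+ 2 <= inner p u u.
Proof.
move=> v1; have := inner_ge0 p (u + (- inner p u v) *: v).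
rewrite innerDl innerZl !(innerC _ _ (_ + _)) !innerDl !innerZl v1 (innerC p v u).
lra.
Qed.

End Frame.

(** * The gradient in the Frenet frame *)

(** Stated apart because unfolding the recursion by simplification would also
    unfold its inner occurrences. *)
Lemma harmonic_curvatureSS (R : realType) (I : set R) (k : nat -> R -> R) j s :
  harmonic_curvature I k j.+2 s = (k j.+3 s)^-1 *
    (deriv_in I (harmonic_curvature I k j.+1) s +
     k j.+2 s * harmonic_curvature I k j s).
Proof. by []. Qed.

Section Helix.
Context {R : realType} {n : nat} {M : riemannian R n}.
Context (f : M -> R) (I : set R) (alpha : R -> M).
Context (V : nat -> R -> 'rV[R]_n) (k : nat -> R -> R).
Context (Mcomplete : complete_riemannian M) (fsmooth : smooth_fun f).
Context (faffine : affine_function f) (hfrenet : frenet_curve I alpha V k).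

(** As the gradient of [f] is parallel, its components in the frame satisfy the
    Frenet equations. *)
Lemma frame_component_slope i s : (1 <= i <= n)%N -> I s ->
  slope (fun t => dfun f (alpha t) (V i t)) s @ within I s^' -->
  - k i.-1 s * dfun f (alpha s) (V i.-1 s) + k i s * dfun f (alpha s) (V i.+1 s).
Proof.
move=> hi Is; have [[Ii sm] _ [Vsm _] _ frenet] := hfrenet.
have cs := chart_at_dom (alpha s); have ca := chart_at_atlas (alpha s).
have dW : derivable_in I (fun t => tcoord (chart_at (alpha s)) (alpha t) (V i t)) s.
  have := Vsm _ hi _ ca 0%N s (conj Is cs).
  by rewrite /derivable_in /= (within_curve_cdom sm.1 Is cs).
have := dfun_slope fsmooth Ii sm Is dW.
by rewrite (hessian0 _ _ _ Mcomplete fsmooth faffine) add0r (frenet _ _ hi Is) dfunD !dfunZ.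
Qed.

(** The Frenet equation for the derivative of the component along V_(i+1),
    solved for the component along V_(i+2), is the recursion that defines the
    harmonic curvatures; it needs k_(i+1) to be nonzero, hence i + 2 <= n. *)
Lemma frame_component_helix c :
  (forall s, I s -> dfun f (alpha s) (V 1%N s) = c) -> c != 0 ->
  forall i s, (i.+2 <= n)%N -> I s ->
  dfun f (alpha s) (V i.+2 s) = c * harmonic_curvature I k i s.
Proof.
move=> l1 c0; have [[Ii sm] [_ V0] _ kpos _] := hfrenet.
have knz i s : (1 <= i < n)%N -> I s -> k i s != 0.
  by move=> hi Is; rewrite gt_eqF // kpos.
have l0 s : I s -> dfun f (alpha s) (V 0%N s) = 0.
  by move=> Is; rewrite (V0 _ Is).1 dfun0.
elim/ltn_ind => i IH s hi Is.
case: i => [|[|j]] in IH hi *.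
- (* the component along V_1 is constant, so the one along V_2 vanishes *)
  have H := @frame_component_slope 1 s (ltnW hi) Is.
  have := slope_cvg_unique Ii Is H (slope_cvg_const l1 Is).
  rewrite /= l0 // mulr0 add0r mulr0 => /eqP.
  by rewrite mulf_eq0 (negbTE (knz _ _ _ _)) // => /eqP.
- have l2 t : I t -> dfun f (alpha t) (V 2%N t) = 0.
    by move=> It; rewrite (IH 0%N) ?mulr0 //; exact: ltnW.
  have H := @frame_component_slope 2 s (ltnW hi) Is.
  have := slope_cvg_unique Ii Is H (slope_cvg_const l2 Is).
  rewrite /= l1 // => E; have k2 := knz 2%N s hi Is.
  apply: (mulfI k2); rewrite mulrCA [X in c * X]mulrC divfK //.
  by move: E; rewrite addrC mulNr => /subr0_eq ->; rewrite mulrC.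
have lj t : I t -> dfun f (alpha t) (V j.+3 t) = c * harmonic_curvature I k j.+1 t.
  by move=> It; apply: IH => //; exact: ltnW.
have H := @frame_component_slope j.+3 s (ltnW hi) Is.
set D := _ + _ in H.
(* H_(j+1) is differentiable because on I it is the component divided by c *)
have HD : slope (harmonic_curvature I k j.+1) s @ within I s^' --> c^-1 * D.
  apply: (@near_eq_slope _ _ _ (fun t => c^-1 * dfun f (alpha t) (V j.+3 t))).
  - by apply: filterS (near_withinT I _) => t It; rewrite lj // mulKf.
  - by rewrite lj // mulKf.
  rewrite (_ : slope _ _ = (fun t => c^-1 *
      slope (fun t => dfun f (alpha t) (V j.+3 t)) s t)).
    by apply: cvgM => //; exact: cvg_cst.
  by apply/funext => t; rewrite /slope -mulrBr /GRing.scale /= mulrCA.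
rewrite harmonic_curvatureSS (deriv_in_eq Ii Is HD).
have kj := knz j.+3 s hi Is.
rewrite /D /= (IH j) //; last by do 2 apply: ltnW.
field.
by apply/andP.
Qed.

End Helix.

Unset Implicit Arguments.
Set Strict Implicit.

Theorem theorem3p2 (R : realType) (n : nat) (hn : (3 <= n)%N)
    (M : riemannian R n)
    (Mconnected : connected [set: M])
    (Mcomplete : complete_riemannian M)
    (Mproduct : exists (m : nat) (N : riemannian R m),
        isometric_to_line_product M N)
    (f : M -> R) (fsmooth : smooth_fun f)
    (faffine : affine_function f) (fnontrivial : nonconstant f)
    (I : set R) (alpha : R -> M)
    (V : nat -> R -> 'rV[R]_n) (k : nat -> R -> R)
    (hfrenet : frenet_curve I alpha V k)
    (hhelix : eikonal_helix f I alpha V) :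
  let H := harmonic_curvature I k in
  exists theta : R,
    (forall s, I s -> angle (alpha s) (grad f (alpha s)) (V 1%N s) = theta) /\
    (forall s, I s ->
       inner (alpha s) (grad f (alpha s)) (V 1%N s)
         = tnorm (alpha s) (grad f (alpha s)) * cos theta) /\
    (forall s, I s ->
       grad f (alpha s)
         = (tnorm (alpha s) (grad f (alpha s)) * cos theta) *:
             (V 1%N s + \sum_(1 <= i < n.-1) H i s *: V i.+2 s)).
Proof.
move=> H; have [[C hC] [c [c0 hc]]] := hhelix.
have [[[_ [s0 [_ [Is0 _ _]]]] _] _ [_ Vo] _ _] := hfrenet.
have n1 : (1 <= 1 <= n)%N by exact: leq_trans hn.
have V11 s : I s -> inner (alpha s) (V 1%N s) (V 1%N s) = 1.
  by move=> Is; rewrite Vo.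
(* |c| <= C makes acos (c / C) an angle whose cosine is c / C *)
have cC : c ^+ 2 <= C ^+ 2.
  rewrite -(hc _ Is0) -(hC _ Is0) /tnorm sqr_sqrtr ?inner_ge0 //.
  by apply: inner_unit_le; exact: V11.
have C0 : 0 < C.
  rewrite lt_neqAle -{2}(hC _ Is0) sqrtr_ge0 andbT eq_sym.
  apply: contraNneq c0 => C0; rewrite C0 expr0n /= in cC.
  by rewrite -sqrf_eq0 eq_le cC sqr_ge0.
have cosE : C * cos (acos (c / C)) = c.
  rewrite acosK; first by rewrite mulrC divfK // gt_eqF.
  rewrite in_itv /= -ler_norml -(@ler_pXn2r _ 2) ?nnegrE ?ler01 ?normr_ge0 //.
  by rewrite expr1n real_normK ?num_real // expr_div_n ler_pdivrMr ?mul1r ?exprn_gt0.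
exists (acos (c / C)); split=> [s Is|].
  by rewrite /angle hc // hC // /tnorm V11 // sqrtr1 mulr1.
split=> s Is; rewrite hC // cosE; first exact: hc.
(* the components of the gradient in the frame: c, 0, c H_1, c H_2, and so on *)
pose lam i := dfun f (alpha s) (V i s).
have l1 t : I t -> dfun f (alpha t) (V 1%N t) = c by move=> It; rewrite -gradP hc.
have lamE i : (i.+2 <= n)%N -> lam i.+2 = c * H i s.
  by move=> hi; exact: (frame_component_helix Mcomplete fsmooth faffine hfrenet l1 c0).
have eo (i j : 'I_n) : inner (alpha s) (V i.+1 s) (V j.+1 s) = (i == j)%:R.
  exact: (Vo i.+1 j.+1 s (ltn_ord i) (ltn_ord j) Is).
rewrite {1}(orthonormal_expansion (grad f (alpha s)) eo).
under eq_bigr do rewrite gradP -/(lam _.+1).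
rewrite -(big_mkord xpredT (fun i => lam i.+1 *: V i.+1 s)).
(* V_1 and V_2 leave the sum, whose index then shifts by one *)
rewrite big_ltn; last exact: leq_trans hn.
rewrite big_ltn; last exact: leq_trans hn.
rewrite big_add1 /= {1}/lam l1 // lamE; last exact: leq_trans hn.
rewrite mulr0 scale0r add0r scalerDr scaler_sumr; congr (_ + _).
apply: eq_big_nat => i /andP[_ hi]; rewrite lamE ?scalerA //.
by rewrite -ltn_predRL.
Qed.
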